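(* Let $X\subseteq\mathbb R^K$ be compact and suppose that: (i) $\sup_{u \in X} \| \mathcal G(u) - m^{\mathcal G}_N(u)\|$, $\sup_{u \in X} | \Phi(u) - m^\Phi_N(u)|$ and $\sup_{u \in X} k_N(u,u)$ (sequences of real numbers indexed by $N\in\mathbb N$) converge to $0$ as $N\to\infty$; (ii) $\sup_{u \in X}\|\mathcal G(u)\| \leq C_{\mathcal G} < \infty$; (iii) for every $N\in\mathbb N$, each of the pairs $(f,g)=(\Phi_N-m_N^\Phi,\ \Phi_0)$ and $(f,g)=(\mathcal G_N^j-m_N^{\mathcal G^j},\ \mathcal G_0^j)$, $j\in\{1,\dots,J\}$, consists of almost surely bounded Gaussian fields on $X$ with $\mathbb E(f(u))=\mathbb E(g(u))$ and $\mathbb E\big((f(u)-f(u'))^2\big)\le\mathbb E\big((g(u)-g(u'))^2\big)$ for all $u,u'\in X$. Then there exist constants $C_1$ and $C_2$, independent of $N$ and of the design points $U_N$, such that for any $\delta>0$ and all $N$ $$d_{\mathrm{Hell}}(\mu^y, \mu^{y,N,\mathcal G}_{\mathrm{marginal}}) \leq C_1 \left\|\Big(\mathbb E_{\nu_N^{\mathcal G}} \big(\|\mathcal G - \mathcal G_N \|^{1 + \delta} \big)\Big)^{1/(1+\delta)}\right\|_{L^2_{\mu_0}(X)},$$ $$d_{\mathrm{Hell}}(\mu^y, \mu^{y,N,\Phi}_{\mathrm{marginal}}) \leq C_2 \left\|\Big(\mathbb E_{\nu_N^\Phi} \big( |\Phi - \Phi_N| ^{1 + \delta} \big)\Big)^{1/(1+\delta)}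 \right\|_{L^2_{\mu_0}(X)}.$$
   Context: Let $K,J\in\mathbb N$, $X\subseteq\mathbb R^K$, let $\mathcal G=(\mathcal G^1,\dots,\mathcal G^J): X\to\mathbb R^J$ be measurable (the parameter-to-observation map), let $y\in\mathbb R^J$ and $\sigma_\eta^2>0$ be fixed, and let $\mu_0$ be a probability measure on $\mathbb R^K$ with $\mu_0(X)=1$ (the prior). $\|\cdot\|$ is the Euclidean norm. Define $\Phi(u)=\frac1{2\sigma_\eta^2}\|y-\mathcal G(u)\|^2$, $Z=\mathbb E_{\mu_0}(\exp(-\Phi(u)))$, and the posterior $\mu^y$ by $\frac{d\mu^y}{d\mu_0}(u)=\frac1Z\exp(-\Phi(u))$. Gaussian process emulators: $\Phi_0$ and $\mathcal G_0^j$ ($1\le j\le J$) denote the initial (prior) Gaussian process models on $X$ for $\Phi$ and $\mathcal G^j$, and for each $N\in\mathbb N$, $\Phi_N$ and $\mathcal G_N^j$ denote the predictive Gaussian processes obtained by conditioning on the values of $\Phi$, resp. $\mathcal G^j$, at a set $U_N\subseteq X$ of $N$ distinct design points. $\Phi_N$ is a Gaussian process on $X$ with mean function $m_N^\Phi$ and covariance function $k_N$; $\mathcal G_N^j$ is a Gaussian process with mean function $m_N^{\mathcal G^j}$ and the same covariance function $k_N$; the processes $\mathcal G_N^1,\dots,\mathcal G_N^J$ are independent, $\mathcal G_N=(\mathcal G_N^1,\dots,\mathcal G_N^J)$ and $m_N^{\mathcal G}=(m_N^{\mathcal G^1},\dots,m_N^{\mathcal G^J})$. All processes have continuous sample paths;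 $\nu_N^\Phi$ denotes the law of $\Phi_N$ on $C^0(X)$ and $\nu_N^{\mathcal G}=\prod_{j}\nu_N^{\mathcal G^j}$ the law of $\mathcal G_N$ on $C^0(X;\mathbb R^J)$, for $N\in\mathbb N\cup\{0\}$. No particular formula for $m_N^{\mathcal G},m_N^\Phi,k_N$ is assumed; only the hypotheses in the claim are required of the emulators. The expectations $\mathbb E$ in hypothesis (iii) are with respect to the laws of the respective processes. In the conclusion, $\mathbb E_{\nu_N^{\mathcal G}}(\|\mathcal G-\mathcal G_N\|^{1+\delta})$ denotes the function $u\mapsto\mathbb E_{\nu_N^{\mathcal G}}(\|\mathcal G(u)-\mathcal G_N(u)\|^{1+\delta})$, and similarly for $\Phi$. With the random normalising constants $$Z_{N,\mathcal G}^{\mathrm{sample}}=\mathbb E_{\mu_0}\Big(\exp\Big(-\frac1{2\sigma_\eta^2}\|y-\mathcal G_N(u)\|^2\Big)\Big),\qquad Z_{N,\Phi}^{\mathrm{sample}}=\mathbb E_{\mu_0}\big(\exp(-\Phi_N(u))\big),$$ the marginal approximations of the posterior are the probability measures given by $$\frac{d\mu^{y,N,\mathcal G}_{\mathrm{marginal}}}{d\mu_0}(u)=\frac{1}{\mathbb E_{\nu_N^{\mathcal G}}(Z_{N,\mathcal G}^{\mathrm{sample}})}\,\mathbb E_{\nu_N^{\mathcal G}}\Big(\exp\Big(-\frac1{2\sigma_\eta^2}\|y-\mathcal G_N(u)\|^2\Big)\Big),$$ $$\frac{d\mu^{y,N,\Phi}_{\mathrm{marginal}}}{d\mu_0}(u)=\frac{1}{\mathbb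 E_{\nu_N^{\Phi}}(Z_{N,\Phi}^{\mathrm{sample}})}\,\mathbb E_{\nu_N^{\Phi}}\big(\exp(-\Phi_N(u))\big).$$ The Hellinger distance between probability measures $\mu,\mu'$ absolutely continuous with respect to $\mu_0$ is $d_{\mathrm{Hell}}(\mu,\mu')=\Big(\frac12\int_X\big(\sqrt{d\mu/d\mu_0}-\sqrt{d\mu'/d\mu_0}\big)^2d\mu_0\Big)^{1/2}$. *)

(* Defs.v *)
From HB Require Import structures.
From mathcomp Require Import all_boot all_order all_algebra finmap.
From mathcomp Require Import all_classical all_reals all_analysis.

Set Implicit Arguments.
Unset Strict Implicit.
Unset Printing Implicit Defensive.

Import Order.TTheory GRing.Theory Num.Theory.
Import numFieldNormedType.Exports.

Local Open Scope classical_set_scope.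
Local Open Scope ring_scope.

(* R^n with its Borel sigma-algebra; the carrier is convertible to 'rV[R]_n. *)
Definition borel_rV (R : realType) (n : nat) :=
  g_sigma_algebraType (@open 'rV[R]_n).

(* The library norm on 'rV[R]_n is the sup norm. *)
Definition enorm (R : realType) (n : nat) (x : 'rV[R]_n) : R :=
  Num.sqrt (\sum_i x 0 i ^+ 2).

Definition supE (R : realType) (U : Type) (X : set U) (f : U -> R) : \bar R :=
  ereal_sup [set (f u)%:E | u in X].

Section GaussianProcesses.
Context (R : realType) (d : measure_display) (Omega : measurableType d)
        (P : probability Omega R) (K : nat) (X : set 'rV[R]_K).
Implicit Types f g : Omega -> 'rV[R]_K -> R.

(* N(m, v); the case v = 0 is separate because the library's [normal_prob m 0]
   is not the Dirac mass at m. *)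
Definition gaussian_measure (m v : R) (A : set R) : \bar R :=
  if v == 0 then \d_m A else normal_prob m (Num.sqrt v) A.

Definition gaussian_rv (Y : Omega -> R) (m v : R) : Prop :=
  [/\ measurable_fun setT Y, 0 <= v &
      forall A, measurable A -> P (Y @^-1` A) = gaussian_measure m v A].

(* The finite-dimensional distributions over X are (possibly degenerate)
   multivariate normal: every linear combination of coordinates is normal. *)
Definition gaussian_process f (m : 'rV[R]_K -> R) (k : 'rV[R]_K -> 'rV[R]_K -> R)
    : Prop :=
  forall (n : nat) (u : 'I_n -> 'rV[R]_K) (a : 'I_n -> R),
    (forall i, X (u i)) ->
    gaussian_rv (fun w => \sum_i a i * f w (u i))
                (\sum_i a i * m (u i))
                (\sum_i \sum_j a i * a j * k (u i) (u j)).

Definition gaussian_field f : Prop := exists m k, gaussian_process f m k.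

Definition continuous_paths f : Prop :=
  forall w, {within X, continuous (f w)}.

Definition process_sigma f : set (set Omega) :=
  <<s [set A | exists u B, [/\ X u, measurable B &
                              A = (fun w => f w u) @^-1` B]] >>.

(* The index set 'I_J being finite, the product rule for the full family gives
   it for subfamilies by taking A j = setT. *)
Definition independent_processes (J : nat) (f : 'I_J -> Omega -> 'rV[R]_K -> R)
    : Prop :=
  forall A : 'I_J -> set Omega, (forall j, process_sigma (f j) (A j)) ->
    P (\bigcap_(j in [set: 'I_J]) A j) = (\prod_(j < J) P (A j))%E.

Definition as_bounded f : Prop :=
  {ae P, forall w, exists M : R, forall u, X u -> `|f w u| <= M}.

Definition increments_dominated f g : Prop :=
  [/\ gaussian_field f /\ as_bounded f,
      gaussian_field g /\ as_bounded g,
      (forall u, X u -> 'E_P[fun w => f w u] = 'E_P[fun w => g w u])%E &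
      (forall u u', X u -> X u' ->
         'E_P[fun w => ((f w u - f w u') ^+ 2)%R]
           <= 'E_P[fun w => ((g w u - g w u') ^+ 2)%R])%E].

Definition prior_processes (J : nat) (Phi0 : Omega -> 'rV[R]_K -> R)
    (G0 : 'I_J -> Omega -> 'rV[R]_K -> R) : Prop :=
  [/\ gaussian_field Phi0 /\ continuous_paths Phi0,
      (forall j, gaussian_field (G0 j) /\ continuous_paths (G0 j)) &
      independent_processes G0].

Definition predictive_processes (J : nat)
    (PhiN : Omega -> 'rV[R]_K -> R) (GN : 'I_J -> Omega -> 'rV[R]_K -> R)
    (mPhi : 'rV[R]_K -> R) (mG : 'rV[R]_K -> 'rV[R]_J)
    (k : 'rV[R]_K -> 'rV[R]_K -> R) : Prop :=
  [/\ gaussian_process PhiN mPhi k /\ continuous_paths PhiN,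
      (forall j, gaussian_process (GN j) (fun u => mG u 0 j) k /\
                 continuous_paths (GN j)) &
      independent_processes GN].

End GaussianProcesses.

Definition vector_process (R : realType) (Omega : Type) (K J : nat)
    (f : 'I_J -> Omega -> 'rV[R]_K -> R) (w : Omega) (u : 'rV[R]_K) : 'rV[R]_J :=
  \row_j f j w u.

Section Posteriors.
Context (R : realType) (K J : nat) (X : set 'rV[R]_K)
        (mu0 : probability (borel_rV R K) R).

Definition misfit (y : 'rV[R]_J) (sigma2 : R) (z : 'rV[R]_J) : R :=
  enorm (y - z) ^+ 2 / (2 * sigma2).

Definition density_wrt (mu : probability (borel_rV R K) R) (p : 'rV[R]_K -> R)
    : Prop :=
  mu `<< mu0 /\
  ae_eq mu0 X (Radon_Nikodym (charge_of_finite_measure mu) mu0) (EFin \o p).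

Definition posterior_density (Phi : 'rV[R]_K -> R) (u : 'rV[R]_K) : R :=
  expR (- Phi u) / (\int[mu0]_(v in X) expR (- Phi v))%R.

(* Marginal approximation for a random potential Psi; expectations under the
   law of Psi are taken on the underlying probability space. *)
Definition marginal_density (d : measure_display) (Omega : measurableType d)
    (P : probability Omega R) (Psi : Omega -> 'rV[R]_K -> R) (u : 'rV[R]_K) : R :=
  let Zsample w := (\int[mu0]_(v in X) expR (- Psi w v))%R in
  fine 'E_P[fun w => expR (- Psi w u)]%E / fine 'E_P[Zsample]%E.

Definition hellinger (mu mu' : probability (borel_rV R K) R) : \bar R :=
  let p := Radon_Nikodym (charge_of_finite_measure mu) mu0 in
  let p' := Radon_Nikodym (charge_of_finite_measure mu') mu0 in
  ((2^-1)%:E * \int[mu0]_(u in X)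
     ((Num.sqrt (fine (p u)) - Num.sqrt (fine (p' u))) ^+ 2)%:E) `^ 2^-1.

Definition L2norm (f : 'rV[R]_K -> \bar R) : \bar R := 'N[mu0]_(2%:E)[f \_ X].

End Posteriors.

Definition design (R : realType) (K : nat) (X : set 'rV[R]_K) (N : nat)
    (U : {fset 'rV[R]_K}) : Prop :=
  [set` U] `<=` X /\ #|` U|%fset = N.

(* Main.v *)
Require Import Defs.
From HB Require Import structures.
From mathcomp Require Import all_boot all_order all_algebra finmap.
From mathcomp Require Import all_classical all_reals all_analysis.
From mathcomp Require Import measurable_realfun ring lra.

Set Implicit Arguments.
Unset Strict Implicit.
Unset Printing Implicit Defensive.

Import Order.TTheory GRing.Theory Num.Theory.
Import numFieldNormedType.Exports.

Local Open Scope classical_set_scope.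
Local Open Scope ring_scope.

(** The proof compares densities pointwise.

    Write r = exp(-Phi) for the unnormalised posterior density and r_N for the
    unnormalised marginal density E exp(-Phi_N), where Phi_N stands for the
    random potential, built from G_N or from the emulator of Phi. Since G is
    bounded on X, so is the misfit Phi, and r is bounded below by some a > 0.
    All measures involved are probability measures, so the normalising
    constants Z and Z_N in their densities r / Z and r_N / Z_N are the
    integrals of r and r_N. Splitting the difference of the square roots into
    a part coming from r - r_N and a part coming from Z - Z_N, and controlling
    the latter by the former through |Z - Z_N| <= ||r - r_N||_1 <=
    ||r - r_N||_2, gives d_Hell <= (2 / a) ||r - r_N||_2
    ([hellinger_integral_le]), where the only lower bounds involved are r >= a
    and its consequence Z >= a.

    It remains to bound |r - r_N| pointwise by C (E |error|^(1+delta))^(1/(1+delta))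
    with C independent of N and of delta. By Jensen's inequality
    ([expectation_le_powR]) it is enough to bound it by C E |error|; this is
    what makes the constants uniform in delta.

    For G this holds because z |-> exp(-|y - z|^2 / (2 sigma^2)) is globally
    Lipschitz ([expRN_misfit_lipschitz]).

    For Phi the exponential is not Lipschitz on the half line where the
    emulator is negative, and normality is used instead. If Y is N(m, v), then
    E exp(-Y) = exp(-m + v/2) is explicit. Its distance to exp(-a) is of order
    E|Y - a| + v, because exp(t) >= 1 - |t| gives
    E exp(h (Y - a)) >= 1 - E|Y - a| for h = 1 and h = -1, while the bound on
    the normal density prevents Y from concentrating near a, so that
    sqrt v <= 4 E|Y - a| ([gaussian_rv_abs_moment]). The constants depend on m
    and v only through upper bounds for |Phi - m_N| and k_N(u, u), which the
    convergence of these sequences makes uniform in N ([gaussian_rv_expRN_le]). *)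

(** * Integrals and expectations *)

Section Integrals.
Context d (T : measurableType d) (R : realType).
Local Open Scope ereal_scope.

(** The integral of a nonnegative function is a supremum over the simple
    functions below it, hence monotone on all functions. This is applied to the
    emulator error as a function of the input, whose measurability would
    require a joint measurability argument. *)
Lemma ge0_le_integral_nonmeasurable (mu : {measure set T -> \bar R})
    (f g : T -> \bar R) :
  (forall x, 0 <= f x) -> (forall x, f x <= g x) ->
  \int[mu]_x f x <= \int[mu]_x g x.
Proof.
move=> f0 fg.
have g0 x : 0 <= g x by exact: le_trans (f0 x) (fg x).
rewrite !ge0_integralTE//; apply: le_ereal_sup => _ [h hf <-].
by exists h => // x; exact: le_trans (hf x) (fg x).
Qed.

(** Jensen's inequality for x |-> x^p, obtained from Hoelder's inequality
    against the constant 1, which has norm 1 under a probability. *)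
Lemma expectation_le_powR (P : probability T R) (f : T -> R) (p : R) :
  (1 < p)%R -> measurable_fun setT f -> (forall x, 0 <= f x)%R ->
  'E_P[f] <= 'E_P[fun x => f x `^ p]%R `^ p^-1.
Proof.
move=> p1 mf f0.
have p0 : (0 < p)%R by exact: lt_trans p1.
have q0 : (0 < (1 - p^-1)^-1)%R by rewrite invr_gt0 subr_gt0 invf_lt1.
have pq : (p^-1 + (1 - p^-1)^-1^-1 = 1)%R by rewrite invrK subrKC.
have := @hoelder _ _ _ P f (cst 1%R) p _ mf (measurable_cst _) p0 q0 pq.
rewrite Lnorm_cst1 [X in _ * X `^ _]probability_setT poweR1r mule1 Lnorm1.
rewrite [X in X <= _ -> _](_ : _ = 'E_P[f]); last first.
  rewrite unlock; apply: eq_integral => x _ /=.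
  by rewrite mulr1 ger0_norm.
rewrite [X in _ <= X -> _](_ : _ = 'E_P[fun x => f x `^ p]%R `^ p^-1)//.
rewrite !unlock; congr (_ `^ _); apply: eq_integral => x _ /=.
by rewrite ger0_norm.
Qed.

End Integrals.

(** * Hellinger distance between normalised densities *)

Section Hellinger.
Context d (T : measurableType d) (R : realType) (X : set T)
        (mu0 : probability T R).
Hypotheses (mX : measurable X) (X1 : mu0 X = 1%E).
Implicit Types (p q : T -> \bar R) (r : T -> R).

Lemma ae_in_full : {ae mu0, forall u, X u}.
Proof.
exists (~` X); split => //; first exact: measurableC.
by rewrite probability_setC// X1 subee.
Qed.

(** The properties of a Radon-Nikodym derivative that the comparison of
    densities relies on, for a density given as r / Z on X. *)
Definition normalized_density p r (Z : R) :=
  [/\ mu0.-integrable setT p, forall u, p u \is a fin_num,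
      (\int[mu0]_u p u = 1)%E & ae_eq mu0 X p (fun u => (r u / Z)%:E)].

(** A constant Z = 0 would make the density vanish almost everywhere,
    contradicting total mass one. Since Num.sqrt is zero on negative numbers,
    replacing p by its positive part leaves the square roots unchanged
    everywhere, while q becomes nonnegative everywhere. *)
Lemma normalized_density_repr p r (Z : R) :
  (forall u, X u -> 0 <= r u) -> 0 <= Z -> normalized_density p r Z ->
  0 < Z /\ exists q : T -> R,
  [/\ measurable_fun setT q, forall u, 0 <= q u, (\int[mu0]_u (q u)%:E = 1)%E,
      {ae mu0, forall u, X u /\ Z * q u = r u} &
      forall u, Num.sqrt (fine (p u)) = Num.sqrt (q u)].
Proof.
move=> r0 Z0 [ip fp Ip pae].
have mp : measurable_fun setT p by exact: measurable_int ip.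
pose q u := Num.max (fine (p u)) 0.
have mq : measurable_fun setT q.
  by apply: measurable_maxr => //; exact: measurableT_comp.
have q0 u : 0 <= q u by rewrite /q le_max lexx orbT.
have {}pae : {ae mu0, forall u, X u /\ p u = (r u / Z)%:E}.
  by move: ae_in_full pae; apply: filterS2 => u Xu /(_ Xu).
have pq : {ae mu0, forall u, setT u -> (q u)%:E = p u}.
  apply: filterS pae => u [Xu pu] _; rewrite /q -[in RHS](fineK (fp u)).
  by congr EFin; apply/max_idPl; rewrite pu/= divr_ge0// r0.
have Iq : (\int[mu0]_u (q u)%:E = 1)%E.
  by rewrite -Ip; apply: ae_eq_integral => //; exact/measurable_EFinP.
have Zgt0 : 0 < Z.
  rewrite lt_def Z0 andbT; apply/eqP => Z_eq0; move: Iq.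
  rewrite (ae_eq_integral (cst 0%E))//.
  - by rewrite integral0 => /eqP; rewrite eqe eq_sym oner_eq0.
  - exact/measurable_EFinP.
  - apply: filterS2 pae pq => u [_ pu] /(_ Logic.I) -> _.
    by rewrite pu Z_eq0 invr0 mulr0.
split => //; exists q; split => //.
- apply: filterS2 pae pq => u [Xu pu] /(_ Logic.I); rewrite pu => -[->].
  by split => //; rewrite mulrC divfK// gt_eqF.
- move=> u; rewrite /q; case: (leP (fine (p u)) 0) => // h.
  by rewrite sqrtr0 ler0_sqrtr.
Qed.

(** From sqrt Z (sqrt q - sqrt q') = (sqrt (Z q) - sqrt (Z' q'))
    - sqrt q' (sqrt Z - sqrt Z'), and |sqrt b - sqrt b'| <= |b - b'| / sqrt b
    applied with b = Z q and with b = Z, both of which are at least a. *)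
Lemma normalized_sqrt_diff_le (a Z Z' q q' : R) :
  0 < a -> a <= Z -> 0 < Z' -> a <= Z * q -> 0 <= q' ->
  (Num.sqrt q - Num.sqrt q') ^+ 2 <=
  2 / a ^+ 2 * ((Z * q - Z' * q') ^+ 2 + (Z - Z') ^+ 2 * q').
Proof.
move=> a0 aZ Z'0 aZq q'0.
have Z0 : 0 < Z by exact: lt_le_trans aZ.
have q0 : 0 <= q by rewrite -(pmulr_rge0 _ Z0) (le_trans _ aZq)// ltW.
set s := Num.sqrt q; set s' := Num.sqrt q'.
set z := Num.sqrt Z; set z' := Num.sqrt Z'.
have sE : s ^+ 2 = q by rewrite sqr_sqrtr.
have s'E : s' ^+ 2 = q' by rewrite sqr_sqrtr.
have zE : z ^+ 2 = Z by rewrite sqr_sqrtr// ltW.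
have z'E : z' ^+ 2 = Z' by rewrite sqr_sqrtr// ltW.
have [s0 s'0 z0 z'0] : [/\ 0 <= s, 0 <= s', 0 <= z & 0 <= z'].
  by split; exact: sqrtr_ge0.
have h1 : a * (z * s - z' * s') ^+ 2 <= (Z * q - Z' * q') ^+ 2.
  have -> : (Z * q - Z' * q') ^+ 2 = (z * s + z' * s') ^+ 2 * (z * s - z' * s') ^+ 2.
    by rewrite -sE -s'E -zE -z'E; ring.
  apply: ler_wpM2r; first exact: sqr_ge0.
  rewrite (le_trans aZq)// -zE -sE -exprMn lerXn2r// ?nnegrE ?addr_ge0 ?mulr_ge0//.
  by rewrite lerDl mulr_ge0.
have h2 : a * (z - z') ^+ 2 <= (Z - Z') ^+ 2.
  have -> : (Z - Z') ^+ 2 = (z + z') ^+ 2 * (z - z') ^+ 2.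
    by rewrite -zE -z'E; ring.
  apply: ler_wpM2r; first exact: sqr_ge0.
  by rewrite (le_trans aZ)// -zE lerXn2r// ?nnegrE ?addr_ge0// lerDl.
have h3 : Z * (s - s') ^+ 2 <= 2 * ((z * s - z' * s') ^+ 2 + (z - z') ^+ 2 * q').
  rewrite -zE -s'E -subr_ge0.
  have -> : 2 * ((z * s - z' * s') ^+ 2 + (z - z') ^+ 2 * s' ^+ 2)
     - z ^+ 2 * (s - s') ^+ 2 = (z * s - z' * s' + (z - z') * s') ^+ 2 by ring.
  exact: sqr_ge0.
rewrite mulrAC ler_pdivlMr ?exprn_gt0//.
apply: (@le_trans _ _ (a * (Z * (s - s') ^+ 2))).
  by rewrite mulrC expr2 -mulrA ler_wpM2l ?(ltW a0)// ler_wpM2r// sqr_ge0.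
apply: (@le_trans _ _ (a * (2 * ((z * s - z' * s') ^+ 2 + (z - z') ^+ 2 * q')))).
  by rewrite ler_wpM2l// ltW.
rewrite mulrCA ler_wpM2l// mulrDr lerD// mulrA.
by rewrite ler_wpM2r.
Qed.

(** Integrating [normalized_sqrt_diff_le] yields ||r - r'||_2^2 + (Z - Z')^2,
    up to the factor 2 / a^2, because q' has integral 1. As Z - Z' is the
    integral of r - r', its square is at most ||r - r'||_2^2, again by
    Jensen's inequality. *)
Lemma hellinger_integral_le p p' r r' (Z Z' a L : R) (D : T -> \bar R) :
  0 < a -> 0 < L -> 0 <= Z -> 0 <= Z' ->
  (forall u, X u -> a <= r u) -> (forall u, X u -> 0 <= r' u) ->
  (forall u, X u -> (`|r u - r' u|%:E <= L%:E * D u)%E) ->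
  normalized_density p r Z -> normalized_density p' r' Z' ->
  (((2^-1)%:E * \int[mu0]_(u in X)
     ((Num.sqrt (fine (p u)) - Num.sqrt (fine (p' u))) ^+ 2)%:E) `^ 2^-1
   <= (2 * L / a)%:E * 'N[mu0]_2%:E[D \_ X])%E.
Proof.
move=> a0 L0 Z0 Z'0 ra r'0 rr'D dp dp'.
have r0 u : X u -> 0 <= r u by move=> /ra; exact/le_trans/ltW.
have [Zgt0 [q [mq q0 Iq qr qE]]] := normalized_density_repr r0 Z0 dp.
have [Z'gt0 [q' [mq' q'0 Iq' qr' q'E]]] := normalized_density_repr r'0 Z'0 dp'.
have int_density (f : T -> R) : measurable_fun setT f ->
    (forall u, 0 <= f u) -> (\int[mu0]_u (f u)%:E = 1)%E ->
    mu0.-integrable setT (EFin \o f).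
  move=> mf f0 If; apply/integrableP; split; first exact/measurable_EFinP.
  under eq_integral do rewrite gee0_abs ?lee_fin//=.
  by rewrite If ltry.
have iq := int_density _ mq q0 Iq.
have iq' := int_density _ mq' q'0 Iq'.
(* Z is the integral of r, which is at least a on a set of full measure. *)
have aZ : a <= Z.
  suff : ((a / Z)%:E <= 1)%E by rewrite lee_fin ler_pdivrMr// mul1r.
  have <- : (\int[mu0]_u (a / Z)%:E = (a / Z)%:E)%E.
    by rewrite integral_cst// [X in (_ * X)%E]probability_setT mule1.
  rewrite -Iq; apply: ae_ge0_le_integral => //.
  - by move=> u _; rewrite lee_fin divr_ge0// ltW.
  - by move=> u _; rewrite lee_fin.
  - exact/measurable_EFinP.
  - apply: filterS qr => u [Xu qu] _.
    by rewrite lee_fin ler_pdivrMr// mulrC qu ra.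
pose h u := Z * q u - Z' * q' u.
have mh : measurable_fun setT h.
  by apply: measurable_funB; apply: measurable_funM.
have mh2 : measurable_fun setT (fun u => h u ^+ 2) by exact: measurable_funX.
pose H := (\int[mu0]_u (h u ^+ 2)%:E)%E.
have H0 : (0 <= H)%E by apply: integral_ge0 => u _; rewrite lee_fin sqr_ge0.
have ZZ' : (((Z - Z') ^+ 2)%:E <= H)%E.
  have h1 : (`|Z - Z'|%:E <= H `^ 2^-1)%E.
    have hE : ((Z - Z')%:E = \int[mu0]_u (h u)%:E)%E.
      rewrite /h; under eq_integral do rewrite EFinB !EFinM.
      rewrite integralB//; [|exact: integrableZl..].
      by rewrite !integralZl// Iq Iq' !mule1.
    rewrite -abse_EFin hE; apply: (le_trans (le_abse_integral _ _ _)) => //.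
      exact/measurable_EFinP.
    have := @expectation_le_powR _ _ _ mu0 (fun u => `|h u|) 2.
    rewrite unlock ltr1n => /(_ isT) H1.
    apply: (le_trans (H1 _ _)) => //; first exact: measurableT_comp.
    rewrite /H le_eqVlt; apply/orP; left; apply/eqP; congr (_ `^ _)%E.
    by apply: eq_integral => u _; rewrite powR_mulrn// real_normK ?num_real.
  have -> : H = ((H `^ 2^-1) `^ 2)%E by rewrite -poweRrM mulVf// poweRe1.
  rewrite -[(Z - Z') ^+ 2]real_normK ?num_real// -powR_mulrn// -poweR_EFin.
  apply: gt0_ler_poweR => //.
  - by rewrite in_itv/= lee_fin normr_ge0 leey.
  - by rewrite in_itv/= poweR_ge0 leey.
have hD : (H `^ 2^-1 <= L%:E * 'N[mu0]_2%:E[D \_ X])%E.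
  (* D is compared with h off a measurable null set N, on which h is set to 0,
     so that the comparison holds everywhere. *)
  have [N [mN N0 hN]] : {ae mu0, forall u, X u /\ `|h u| = `|r u - r' u|}.
    by apply: filterS2 qr qr' => u [Xu qu] [_ q'u]; rewrite /h qu q'u.
  pose h1 u := \1_(~` N) u * h u / L.
  have mh1 : measurable_fun setT h1.
    by apply: measurable_funM => //; apply: measurable_funM => //;
      apply: measurable_indic; exact: measurableC.
  have mh12 : measurable_fun setT (fun u => (h1 u ^+ 2)%:E).
    by apply/measurable_EFinP; exact: measurable_funX.
  have HE : (H = (L ^+ 2)%:E * \int[mu0]_u (h1 u ^+ 2)%:E)%E.
    rewrite -ge0_integralZl_EFin ?sqr_ge0//; last first.
      by move=> u _; rewrite lee_fin sqr_ge0.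
    apply: ae_eq_integral => //; [exact/measurable_EFinP|exact: measurable_funeM|].
    exists N; split => // u /= /not_implyP[_ hu].
    apply: contrapT => Nu; apply: hu; rewrite -EFinM -exprMn /h1 indicE.
    by rewrite mem_set// mul1r mulrC divfK// gt_eqF.
  have DL : (\int[mu0]_u (h1 u ^+ 2)%:E <= \int[mu0]_u (`|(D \_ X) u| `^ 2))%E.
    apply: ge0_le_integral_nonmeasurable => u; first by rewrite lee_fin sqr_ge0.
    rewrite /h1 indicE; have [Nu|Nu] := pselect (N u).
      rewrite memNset; last by move=> /(_ Nu).
      by rewrite !mul0r expr0n poweR_ge0.
    have [Xu hu] : X u /\ `|h u| = `|r u - r' u|.
      by apply: contrapT => /hN.
    rewrite mem_set// mul1r patchE mem_set// -[(h u / L) ^+ 2]real_normK ?num_real//.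
    rewrite -powR_mulrn// -poweR_EFin; apply: gt0_ler_poweR => //.
    - by rewrite in_itv/= lee_fin normr_ge0 leey.
    - by rewrite in_itv/= abse_ge0 leey.
    - rewrite normrM hu normfV (gtr0_norm L0).
      rewrite (le_trans _ (lee_abs _))//.
      by rewrite EFinM muleC lee_pdivrMl// rr'D.
  rewrite unlock HE poweRM ?lee_fin ?sqr_ge0//; last first.
    by apply: integral_ge0 => u _; rewrite lee_fin sqr_ge0.
  rewrite poweR_EFin -(powR_mulrn 2 (ltW L0)) -powRrM divff// powRr1 ?(ltW L0)//.
  apply: lee_wpmul2l; first by rewrite lee_fin ltW.
  apply: gt0_ler_poweR => //; rewrite in_itv/= leey andbT; apply: integral_ge0 => u _.
  - by rewrite lee_fin sqr_ge0.
  - exact: poweR_ge0.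
have hellH : (((2^-1)%:E * \int[mu0]_(u in X)
     ((Num.sqrt (fine (p u)) - Num.sqrt (fine (p' u))) ^+ 2)%:E) `^ 2^-1
     <= (2 / a)%:E * H `^ 2^-1)%E.
  have msq : measurable_fun setT
      (fun u => ((Num.sqrt (q u) - Num.sqrt (q' u)) ^+ 2)%:E).
    apply/measurable_EFinP/measurable_funX/measurable_funB;
      by apply: measurableT_comp => //; apply: continuous_measurable_fun;
        exact: sqrt_continuous.
  under eq_integral do rewrite qE q'E.
  have c0 : 0 <= 2 / a ^+ 2 by rewrite divr_ge0// sqr_ge0.
  have -> : ((2 / a)%:E * H `^ 2^-1 = (((2 / a) ^+ 2)%:E * H) `^ 2^-1)%E.
    rewrite poweRM ?lee_fin ?sqr_ge0// poweR_EFin -powR_mulrn; last first.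
      by rewrite divr_ge0// ltW.
    by rewrite -powRrM divff// powRr1// divr_ge0// ltW.
  apply: gt0_ler_poweR => //.
  - rewrite in_itv/= leey andbT mule_ge0//; apply: integral_ge0 => u _.
    by rewrite lee_fin sqr_ge0.
  - by rewrite in_itv/= leey andbT mule_ge0// lee_fin sqr_ge0.
  apply: (@le_trans _ _ ((2^-1)%:E * ((2 / a ^+ 2)%:E * (H + H))))%E.
    apply: lee_wpmul2l => //.
    apply: (@le_trans _ _ (\int[mu0]_u
        ((Num.sqrt (q u) - Num.sqrt (q' u)) ^+ 2)%:E))%E.
      by apply: ge0_subset_integral => // u _; rewrite lee_fin sqr_ge0.
    apply: (@le_trans _ _ (\int[mu0]_u
        ((2 / a ^+ 2)%:E * ((h u ^+ 2)%:E + ((Z - Z') ^+ 2)%:E * (q' u)%:E))))%E.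
      apply: ae_ge0_le_integral => //.
      - by move=> u _; rewrite lee_fin sqr_ge0.
      - by move=> u _; rewrite mule_ge0 ?adde_ge0 ?mule_ge0 ?lee_fin ?sqr_ge0.
      - apply/measurable_funeM/emeasurable_funD; first exact/measurable_EFinP.
        exact/measurable_funeM/measurable_EFinP.
      - apply: filterS qr => u [Xu qu] _.
        rewrite -!(EFinM, EFinD) lee_fin.
        by apply: normalized_sqrt_diff_le => //; rewrite qu ra.
    rewrite ge0_integralZl_EFin//; first last.
    - apply/emeasurable_funD; first exact/measurable_EFinP.
      exact/measurable_funeM/measurable_EFinP.
    - by move=> u _; rewrite adde_ge0 ?mule_ge0 ?lee_fin ?sqr_ge0.
    apply: lee_wpmul2l; first by rewrite lee_fin.
    rewrite ge0_integralD//; first last.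
    - exact/measurable_funeM/measurable_EFinP.
    - by move=> u _; rewrite mule_ge0 ?lee_fin ?sqr_ge0.
    - exact/measurable_EFinP.
    - by move=> u _; rewrite lee_fin sqr_ge0.
    apply: leeD2l; rewrite ge0_integralZl_EFin ?sqr_ge0//.
    - by rewrite Iq' mule1.
    - by move=> u _; rewrite lee_fin.
    - exact/measurable_EFinP.
  rewrite -mule2n -[(H *+ 2)%E]mule_natl !muleA -!EFinM.
  apply: lee_wpmul2r => //; rewrite lee_fin.
  have -> : 2^-1 * (2 / a ^+ 2) * 2 = 2 / a ^+ 2 by field; rewrite gt_eqF.
  by rewrite exprMn exprVn ler_wpM2r ?invr_ge0 ?sqr_ge0// expr2 ler_peMl// ler1n.
apply: (le_trans hellH); rewrite (mulrAC 2) [X in (_ <= X * _)%E]EFinM -[leRHS]muleA.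
by apply: lee_wpmul2l => //; rewrite lee_fin divr_ge0// ltW.
Qed.
End Hellinger.

(** * Exponential and absolute moments of normal variables *)

Section Gaussian.
Context (R : realType).
Notation leb := (@lebesgue_measure R).

Lemma ge0_integral_normal_prob (m s : R) (f : R -> \bar R) :
  measurable_fun setT f -> (forall x, 0 <= f x)%E ->
  (\int[normal_prob m s]_x f x = \int[leb]_x (f x * (normal_pdf m s x)%:E))%E.
Proof.
move=> mf f0.
have dom := normal_prob_dominates m s.
have mpdf : measurable_fun setT (fun x => (normal_pdf m s x)%:E).
  by apply/measurable_EFinP; exact: measurable_normal_pdf.
have iRN := Radon_Nikodym_SigmaFinite.f_integrable dom.
rewrite -(Radon_Nikodym_SigmaFinite.change_of_variables dom)//.
apply: ae_eq_integral => //.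
- by apply: emeasurable_funM => //; exact: measurable_int iRN.
- exact: emeasurable_funM.
- apply: ae_eqe_mul2l; apply: integral_ae_eq => // A _ mA.
  by rewrite -(Radon_Nikodym_SigmaFinite.f_integral dom).
Qed.

(** Completing the square: exponential tilting shifts the mean of a normal
    density. *)
Lemma expR_normal_pdf (h m s x : R) : s != 0 ->
  expR (h * x) * normal_pdf m s x =
  expR (h * m + h ^+ 2 * s ^+ 2 / 2) * normal_pdf (m + h * s ^+ 2) s x.
Proof.
move=> s0; rewrite !normal_pdfE// mulrCA [RHS]mulrCA /normal_fun -!expRD.
by congr (_ * expR _); field.
Qed.

Context d (T : measurableType d) (P : probability T R).

Lemma gaussian_rv_ge0_integral (Y : T -> R) (m v : R) (f : R -> \bar R) :
  gaussian_rv P Y m v -> measurable_fun setT f -> (forall x, 0 <= f x)%E ->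
  (\int[P]_w f (Y w) =
   if v == 0%R then f m
   else \int[leb]_x (f x * (normal_pdf m (Num.sqrt v) x)%:E))%E.
Proof.
move=> [mY v0 PY] mf f0.
(* [normal_prob] lives on [measurableTypeR R], whose display differs from the
   default one of R, so the law of Y has to be taken on that copy. *)
pose Ym := isMeasurableFun.Build _ _ T (measurableTypeR R) _ mY.
pose Yrv : {RV P >-> measurableTypeR R} := HB.pack Y Ym.
rewrite -(ge0_integral_distribution Yrv mf f0).
move: PY; rewrite /gaussian_measure; case: ifPn => _ PY.
  rewrite (eq_measure_integral (\d_(m : measurableTypeR R) : measure _ _)) => [|A mA _]; last exact: PY.
  by rewrite integral_dirac// diracT mul1e.
rewrite -ge0_integral_normal_prob//.
rewrite (eq_measure_integral (normal_prob m (Num.sqrt v) : measure _ _))// => A mA _.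
exact: PY.
Qed.

Lemma gaussian_rv_mgf (Y : T -> R) (m v h : R) : gaussian_rv P Y m v ->
  ('E_P[fun w => expR (h * Y w)] = (expR (h * m + h ^+ 2 * v / 2))%:E)%E.
Proof.
move=> gY; have [_ v0 _] := gY.
have mexp : measurable_fun setT (fun x : R => expR (h * x)).
  by apply: measurableT_comp => //; exact: measurable_funM.
rewrite unlock (gaussian_rv_ge0_integral (f := fun x => (expR (h * x))%:E) gY)//;
  last exact/measurable_EFinP.
case: eqVneq => [->|v_neq0]; first by rewrite mulr0 mul0r addr0.
have s0 : Num.sqrt v != 0 by rewrite gt_eqF// sqrtr_gt0 lt_def v_neq0.
under eq_integral do rewrite -EFinM expR_normal_pdf// EFinM.
rewrite integralZl//; last exact: integrable_normal_pdf.
by rewrite integral_normal_pdf mule1 sqr_sqrtr.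
Qed.

Lemma normal_prob_itv_le (m s a t : R) : s != 0 -> 0 <= t ->
  (normal_prob m s `[(a - t)%R, (a + t)%R] <= (normal_peak s * (t *+ 2))%:E)%E.
Proof.
move=> s0 t0; rewrite /normal_prob.
apply: (@le_trans _ _ (\int[leb]_(x in `[(a - t)%R, (a + t)%R]) (normal_peak s)%:E)%E).
  apply: ge0_le_integral => //.
  - by move=> x _; rewrite lee_fin normal_pdf_ge0.
  - by apply/measurable_funTS/measurable_EFinP; exact: measurable_normal_pdf.
  - by move=> x _; rewrite lee_fin normal_pdf_ub.
rewrite integral_cst//= EFinM; apply: lee_wpmul2l.
  by rewrite lee_fin normal_peak_ge0.
rewrite lebesgue_measure_itv/=; case: ifPn => _; last by rewrite lee_fin mulrn_wge0.
by rewrite -EFinB lee_fin; lra.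
Qed.

(** A normal variable with standard deviation s has density at most 1 / (s
    sqrt (2 pi)), so an interval of radius t = s sqrt (2 pi) / 4 around a has
    probability at most 1/2; hence E|Y - a| >= t / 2 >= s / 4. *)
Lemma gaussian_rv_abs_moment (Y : T -> R) (m v a : R) : gaussian_rv P Y m v ->
  ((Num.sqrt v)%:E <= 4%:E * 'E_P[fun w => `|Y w - a|%R])%E.
Proof.
move=> [mY v0 PY].
have E0 : (0 <= 'E_P[fun w => `|Y w - a|%R])%E by exact: expectation_ge0.
have [v_eq0|v_neq0] := eqVneq v 0.
  by rewrite v_eq0 sqrtr0 mule_ge0// lee_fin.
set s := Num.sqrt v.
have s0 : 0 < s by rewrite sqrtr_gt0 lt_def v_neq0.
have s_neq0 : s != 0 by rewrite gt_eqF.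
pose t := (normal_peak s)^-1 / 4.
have p0 : 0 < normal_peak s by exact: normal_peak_gt0.
have t0 : 0 < t by rewrite /t divr_gt0// invr_gt0.
pose B := Y @^-1` `[a - t, a + t].
have mB : measurable B by rewrite -(setTI B); exact: mY.
have PB : (P B <= (2^-1)%:E)%E.
  rewrite PY// /gaussian_measure (negbTE v_neq0).
  apply: (le_trans (normal_prob_itv_le _ _ s_neq0 (ltW t0))).
  rewrite lee_fin /t mulrnAr mulrA divff ?gt_eqF//.
  by rewrite -mulr_natr mul1r; lra.
have EtB : ((t / 2)%:E <= 'E_P[fun w => `|Y w - a|%R])%E.
  apply: (@le_trans _ _ (t%:E * P (~` B))%E).
    rewrite EFinM; apply: lee_wpmul2l; first by rewrite lee_fin ltW.
    rewrite probability_setC// leeBrDr; last exact: fin_num_measure.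
    apply: (le_trans (leeD2l _ PB)); rewrite -EFinD lee_fin; lra.
  rewrite -integral_cst; last exact: measurableC.
  rewrite unlock; apply: (@le_trans _ _ (\int[P]_(w in ~` B) `|Y w - a|%R%:E)%E).
    apply: ge0_le_integral => //.
    - exact: measurableC.
    - by move=> w _; rewrite lee_fin ltW.
    - by apply/measurable_funTS/measurable_EFinP/measurableT_comp => //;
        exact: measurable_funB.
    - move=> w Bw; rewrite lee_fin leNgt; apply/negP => h; apply: Bw.
      by rewrite /B/= in_itv/= -ler_distl ltW.
  apply: ge0_subset_integral => //; first exact: measurableC.
  by apply/measurable_EFinP/measurableT_comp => //; exact: measurable_funB.
apply: (@le_trans _ _ (4 * (t / 2))%:E).
  rewrite lee_fin /t /normal_peak invrK.
  have -> : 4 * (Num.sqrt (s ^+ 2 * pi *+ 2) / 4 / 2) =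
     Num.sqrt (s ^+ 2 * pi *+ 2) / 2 by field.
  rewrite ler_pdivlMr// -(@ler_pXn2r _ 2)// ?nnegrE ?mulr_ge0 ?sqrtr_ge0 ?(ltW s0)//.
  have sq0 : 0 <= s ^+ 2 * pi *+ 2 by rewrite mulrn_wge0// mulr_ge0 ?sqr_ge0 ?pi_ge0.
  rewrite (sqr_sqrtr sq0) exprMn -mulrnAr.
  by rewrite ler_wpM2l ?sqr_ge0//; have := pi_ge2 R; lra.
by rewrite EFinM; apply: lee_wpmul2l.
Qed.

(** The expectation of 1 <= |h (Y - a)| + exp(h (Y - a)), where h is 1 or -1.
    It locates the mean m relative to a, up to E|Y - a| and v. *)
Lemma gaussian_rv_expR_centered (Y : T -> R) (m v a h : R) :
  gaussian_rv P Y m v -> h ^+ 2 = 1 ->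
  (1 <= 'E_P[fun w => `|Y w - a|%R] + (expR (h * (m - a) + v / 2))%:E)%E.
Proof.
move=> gY h1; have [mY v0 _] := gY.
have mhY : measurable_fun setT (fun w => expR (h * Y w)).
  by apply: measurableT_comp => //; exact: measurable_funM.
have -> : ((expR (h * (m - a) + v / 2))%:E =
   \int[P]_w ((expR (- (h * a)))%:E * (expR (h * Y w))%:E))%E.
  rewrite ge0_integralZl_EFin ?expR_ge0//.
  - move: (gaussian_rv_mgf h gY); rewrite unlock => ->.
    by rewrite -EFinM -expRD h1; congr (expR _)%:E; ring.
  - exact/measurable_EFinP.
rewrite unlock -ge0_integralD//; first last.
- exact/measurable_funeM/measurable_EFinP.
- by apply/measurable_EFinP/measurableT_comp => //; exact: measurable_funB.
rewrite -[leLHS](_ : (\int[P]_w (cst 1%E w) = 1)%E); last first.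
  by rewrite integral_cst// mul1e; exact: probability_setT.
apply: ge0_le_integral => //.
- apply: emeasurable_funD; last exact/measurable_funeM/measurable_EFinP.
  by apply/measurable_EFinP/measurableT_comp => //; exact: measurable_funB.
move=> w _; rewrite -EFinM -EFinD lee_fin -expRD.
have -> : - (h * a) + h * Y w = h * (Y w - a) by ring.
have hn : `|h * (Y w - a)| = `|Y w - a|.
  suff -> : `|h * (Y w - a)| = `|h| * `|Y w - a|.
    suff -> : `|h| = 1 by rewrite mul1r.
    by rewrite -sqrtr_sqr h1 sqrtr1.
  exact: normrM.
have := expR_ge1Dx (h * (Y w - a)); have := ler_norm (- (h * (Y w - a))).
by rewrite normrN hn; lra.
Qed.

(** Let M = E exp(-Y) and e = E|Y - a|. The case h = -1 of
    [gaussian_rv_expR_centered] bounds exp(-a) - M by e. The case h = 1 gives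
    M <= exp(-a + v) + M e, where M <= exp(E + V/2) and exp(v) - 1 <= v exp(v);
    finally v = sqrt v sqrt v <= sqrt V (4 e). *)
Lemma gaussian_rv_expRN_le (Y : T -> R) (m v a E V : R) :
  gaussian_rv P Y m v -> 0 <= a -> a - m <= E -> v <= V ->
  (`|expR (- a) - fine 'E_P[fun w => expR (- Y w)%R]|%:E <=
   (4 * Num.sqrt V * expR V + expR (E + V / 2) + 1)%:E *
   'E_P[fun w => `|Y w - a|%R])%E.
Proof.
move=> gY a0 amE vV; have [_ v0 _] := gY.
have C0 : 0 < 4 * Num.sqrt V * expR V + expR (E + V / 2) + 1.
  by rewrite ltr_wpDl// addr_ge0 ?expR_ge0// !mulr_ge0 ?sqrtr_ge0 ?expR_ge0.
have -> : fine 'E_P[fun w => expR (- Y w)%R]%E = expR (- m + v / 2).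
  rewrite (_ : (fun w => expR (- Y w)) = fun w => expR (-1 * Y w)); last first.
    by apply/funext => w; rewrite mulN1r.
  by rewrite (gaussian_rv_mgf (-1) gY)/=; congr expR; field.
have := gaussian_rv_abs_moment a gY.
have := gaussian_rv_expR_centered a (h := 1) gY (expr1n _ _).
have := gaussian_rv_expR_centered a (h := -1) gY; rewrite sqrrN expr1n => /(_ erefl).
have : (0 <= 'E_P[fun w => `|Y w - a|%R])%E by exact: expectation_ge0.
case: 'E_P[_]%E => [e| |]; [|by move=> *; rewrite gt0_muley ?lte_fin ?leey|by []].
rewrite -!EFinD -!EFinM !lee_fin => e0 lo up sv.
rewrite ler_norml; apply/andP; split.
  set M := expR (- m + v / 2).
  have up' : M <= expR (- a + v) + M * e.
    have -> : expR (- a + v) = M * expR (1 * (m - a) + v / 2).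
      by rewrite -expRD; congr expR; field.
    by rewrite -mulrDr addrC ler_peMr ?expR_ge0// addrC.
  have ML : M <= expR (E + V / 2) by rewrite ler_expR; lra.
  have ea : expR (- a) <= 1 by rewrite -expR0 ler_expR; lra.
  have ev : expR v - 1 <= expR v * v.
    have := expR_ge1Dx (- v); rewrite -(ler_pM2l (expR_gt0 v)) expRxMexpNx_1.
    lra.
  have evV : expR v <= expR V by rewrite ler_expR.
  have vs : v <= Num.sqrt V * (4 * e).
    rewrite -{1}(sqr_sqrtr v0) expr2.
    by apply: ler_pM => //; rewrite ?sqrtr_ge0// ler_wsqrtr.
  have h1 : expR v * v <= expR V * (Num.sqrt V * (4 * e)).
    by apply: ler_pM => //; exact: expR_ge0.
  have h2 : expR (- a) * (expR v - 1) <= expR v - 1.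
    by rewrite ler_piMl// subr_ge0 -expR0 ler_expR.
  have h3 : M * e <= expR (E + V / 2) * e by rewrite ler_wpM2r.
  rewrite expRD in up'; lra.
have h1 : expR (- a) * 1 <= expR (- a) * (e + expR (-1 * (m - a) + v / 2)).
  by rewrite ler_pM2l ?expR_gt0.
have h2 : expR (- a) * expR (-1 * (m - a) + v / 2) = expR (- m + v / 2).
  by rewrite -expRD; congr expR; ring.
have ea : expR (- a) * e <= e by rewrite ler_piMl// -expR0 ler_expR; lra.
have h3 : 0 <= (4 * Num.sqrt V * expR V + expR (E + V / 2)) * e.
  by rewrite mulr_ge0// addr_ge0 ?expR_ge0// !mulr_ge0 ?sqrtr_ge0 ?expR_ge0.
lra.
Qed.

End Gaussian.

(** * The Euclidean norm *)

Section Euclidean.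
Context (R : realType) (n : nat).
Implicit Types x y z : 'rV[R]_n.

Lemma enorm_ge0 x : 0 <= enorm x.
Proof. exact: sqrtr_ge0. Qed.

Lemma enorm_sqr x : enorm x ^+ 2 = \sum_i x 0 i ^+ 2.
Proof. by rewrite sqr_sqrtr// sumr_ge0// => i _; exact: sqr_ge0. Qed.

Lemma enormN x : enorm (- x) = enorm x.
Proof. by congr Num.sqrt; apply: eq_bigr => i _; rewrite mxE sqrrN. Qed.

(** Cauchy-Schwarz, from Lagrange's identity. *)
Lemma enorm_dot_le x y : \sum_i x 0 i * y 0 i <= enorm x * enorm y.
Proof.
have lagrange : (\sum_i x 0 i * y 0 i) ^+ 2 <= (enorm x * enorm y) ^+ 2.
  have : 0 <= \sum_i \sum_j (x 0 i * y 0 j - x 0 j * y 0 i) ^+ 2.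
    by apply: sumr_ge0 => i _; apply: sumr_ge0 => j _; exact: sqr_ge0.
  suff -> : \sum_i \sum_j (x 0 i * y 0 j - x 0 j * y 0 i) ^+ 2 =
      (enorm x * enorm y) ^+ 2 *+ 2 - (\sum_i x 0 i * y 0 i) ^+ 2 *+ 2.
    by rewrite -mulrnBl pmulrn_lge0// subr_ge0.
  apply/eqP; rewrite eq_sym subr_eq eq_sym; apply/eqP.
  rewrite exprMn !enorm_sqr [RHS]mulr2n {2}mulrC !expr2 !mulr2n !big_distrlr/=.
  rewrite -!big_split; apply: eq_bigr => i _ /=.
  by rewrite -!big_split; apply: eq_bigr => j _ /=; ring.
have xy0 : 0 <= enorm x * enorm y by rewrite mulr_ge0 ?enorm_ge0.
rewrite (le_trans (ler_norm _))// -(@ler_pXn2r _ 2)// ?nnegrE//.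
by rewrite real_normK ?num_real.
Qed.

Lemma enormD_le x y : enorm (x + y) <= enorm x + enorm y.
Proof.
rewrite -(@ler_pXn2r _ 2)// ?nnegrE ?addr_ge0 ?enorm_ge0//.
rewrite sqrrD !enorm_sqr.
have -> : \sum_i (x + y) 0 i ^+ 2 =
    \sum_i x 0 i ^+ 2 + (\sum_i x 0 i * y 0 i) *+ 2 + \sum_i y 0 i ^+ 2.
  rewrite -sumrMnl -!big_split; apply: eq_bigr => i _ /=.
  by rewrite mxE sqrrD.
by rewrite lerD2r lerD2l lerMn2r enorm_dot_le.
Qed.

Lemma enorm_dist x y : `|enorm x - enorm y| <= enorm (x - y).
Proof.
have h (u v : 'rV[R]_n) : enorm u - enorm v <= enorm (u - v).
  rewrite lerBlDr -[X in enorm X <= _](subrK v u); exact: enormD_le.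
by rewrite ler_norml h andbT lerNl opprB -[leRHS]enormN opprB h.
Qed.

End Euclidean.

(** * Lipschitz continuity of the Gaussian likelihood *)

Section GaussianLikelihood.
Context (R : realType).

(** With w = t - s >= 0, the difference is at most exp(-s^2) w (2 s + w). For
    w < 1/2 the bound exp(-s^2) <= 1 / (1 + s^2) concludes; for w >= 1/2 the
    difference is at most 1 <= 2 w. *)
Lemma expRN_sqr_lipschitz (s t : R) : 0 <= s -> 0 <= t ->
  `|expR (- s ^+ 2) - expR (- t ^+ 2)| <= 2 * `|s - t|.
Proof.
wlog st : s t / s <= t => [hw s0 t0|s0 t0].
  have [st|/ltW ts] := leP s t; first exact: hw.
  by rewrite distrC [X in _ <= _ * X]distrC hw.
rewrite [X in _ <= _ * X]distrC (ger0_norm (x := t - s)) ?subr_ge0//.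
have est : expR (- t ^+ 2) <= expR (- s ^+ 2).
  by rewrite ler_expR lerN2 lerXn2r.
rewrite ger0_norm ?subr_ge0//.
have es1 : expR (- s ^+ 2) <= 1 by rewrite -expR0 ler_expR oppr_le0 sqr_ge0.
have [w1|w1] := leP 2^-1 (t - s).
  by have := expR_gt0 (- t ^+ 2); lra.
have es : expR (- s ^+ 2) * (1 + s ^+ 2) <= 1.
  rewrite -[leRHS](expRxMexpNx_1 (s ^+ 2)) mulrC ler_wpM2r ?expR_ge0//.
  exact: expR_ge1Dx.
have -> : expR (- t ^+ 2) = expR (- s ^+ 2) * expR (- (t ^+ 2 - s ^+ 2)).
  by rewrite -expRD; congr expR; ring.
have h := expR_ge1Dx (- (t ^+ 2 - s ^+ 2)).
have e0 := expR_gt0 (- s ^+ 2).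
apply: (@le_trans _ _ (expR (- s ^+ 2) * ((t - s) * (2 * (1 + s ^+ 2))))).
  rewrite -[X in X - _]mulr1 -mulrBr ler_wpM2l ?(ltW e0)//.
  apply: (@le_trans _ _ ((t - s) * (t + s))); first by lra.
  by rewrite ler_wpM2l ?subr_ge0//; nra.
rewrite mulrCA [X in X <= _]mulrCA.
have w0 : 0 <= t - s by rewrite subr_ge0.
nra.
Qed.

Lemma expRN_misfit_lipschitz n (y z z' : 'rV[R]_n) (sigma2 : R) : 0 < sigma2 ->
  `|expR (- misfit y sigma2 z) - expR (- misfit y sigma2 z')| <=
  2 / Num.sqrt (2 * sigma2) * enorm (z - z').
Proof.
move=> s0; have s20 : 0 < 2 * sigma2 by rewrite mulr_gt0.
have mE x : misfit y sigma2 x = (enorm (y - x) / Num.sqrt (2 * sigma2)) ^+ 2.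
  by rewrite /misfit exprMn exprVn [in RHS](sqr_sqrtr (ltW s20)).
rewrite !mE (le_trans (expRN_sqr_lipschitz _ _))// ?divr_ge0 ?enorm_ge0 ?sqrtr_ge0//.
rewrite -mulrBl normrM -mulrA ler_wpM2l// normfV (ger0_norm (sqrtr_ge0 _)) mulrC.
rewrite ler_wpM2l ?invr_ge0 ?sqrtr_ge0//.
rewrite (le_trans (enorm_dist _ _))//.
have -> : y - z - (y - z') = - (z - z') by rewrite !opprB addrC addrA subrK.
by rewrite enormN.
Qed.

End GaussianLikelihood.

(** * Posterior measures and their marginal approximations *)

Section Posteriors.
Context (R : realType) (K : nat) (X : set 'rV[R]_K)
        (mu0 : probability (borel_rV R K) R).

Lemma compact_measurable_borel :
  compact X -> measurable (X : set (borel_rV R K)).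
Proof.
move=> cX; rewrite -[X : set (borel_rV R K)]setCK; apply: measurableC.
apply: sub_sigma_algebra; apply: closed_openC; exact: compact_closed.
Qed.

Lemma density_wrt_normalized (mu : probability (borel_rV R K) R)
    (r : 'rV[R]_K -> R) (Z : R) :
  density_wrt X mu0 mu (fun u => r u / Z) ->
  normalized_density (X : set (borel_rV R K)) mu0
    (Radon_Nikodym (charge_of_finite_measure mu) mu0) r Z.
Proof.
move=> [dom pE].
have numu : charge_of_finite_measure mu `<< mu0 by [].
split => //.
- exact: Radon_Nikodym_integrable.
- by move=> u; exact: Radon_Nikodym_fin_num.
- rewrite -(Radon_Nikodym_integral numu measurableT).
  exact: (@probability_setT _ _ _ mu).
Qed.

Lemma hellinger_le (mu mu' : probability (borel_rV R K) R)
    (r r' : 'rV[R]_K -> R) (Z Z' a L : R) (D : 'rV[R]_K -> \bar R) :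
  compact X -> mu0 X = 1%E -> 0 < a -> 0 < L -> 0 <= Z -> 0 <= Z' ->
  (forall u, X u -> a <= r u) -> (forall u, X u -> 0 <= r' u) ->
  (forall u, X u -> (`|r u - r' u|%:E <= L%:E * D u)%E) ->
  density_wrt X mu0 mu (fun u => r u / Z) ->
  density_wrt X mu0 mu' (fun u => r' u / Z') ->
  (hellinger X mu0 mu mu' <= (2 * L / a)%:E * L2norm X mu0 D)%E.
Proof.
move=> cX X1 a0 L0 Z0 Z'0 ra r'0 rr'D dmu dmu'.
exact: (hellinger_integral_le (compact_measurable_borel cX) X1 a0 L0 Z0 Z'0
  ra r'0 rr'D (density_wrt_normalized dmu) (density_wrt_normalized dmu')).
Qed.

Context (d : measure_display) (Omega : measurableType d)
        (P : probability Omega R).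

Lemma gaussian_process_at (f : Omega -> 'rV[R]_K -> R) m k u :
  gaussian_process P X f m k -> X u ->
  gaussian_rv P (fun w => f w u) (m u) (k u u).
Proof.
move=> gf Xu; have := gf 1%N (fun=> u) (fun=> 1) (fun=> Xu).
rewrite !big_ord1 !mul1r; congr gaussian_rv.
by apply/funext => w; rewrite big_ord1 mul1r.
Qed.

Lemma dist_expectation_le (f : Omega -> R) (c : R) :
  measurable_fun setT f -> (exists M, forall w, `|f w| <= M) ->
  (`|c - fine 'E_P[f]|%:E <= 'E_P[fun w => `|c - f w|%R])%E.
Proof.
move=> mf [M fM].
have intf : P.-integrable setT (EFin \o f).
  apply: measurable_bounded_integrable => //.
    by rewrite -ge0_fin_numE//; exact: fin_num_measure.
  by exists M; split => [|x Mx w _]; rewrite ?num_real//= (le_trans (fM w))// ltW.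
have Ef : ('E_P[f] \is a fin_num)%E by rewrite unlock integrable_fin_num.
rewrite -abse_EFin EFinB fineK// !unlock.
have -> : (c%:E = \int[P]_w (cst c%:E w))%E.
  rewrite integral_cst// [X in (_ * X)%E](_ : _ = 1%E) ?mule1//.
  exact: probability_setT.
rewrite -integralB//; last exact: finite_measure_integrable_cst.
apply: (le_trans (le_abse_integral _ _ _)) => //.
by apply: emeasurable_funB => //; exact/measurable_EFinP.
Qed.

Lemma marginal_density_normalizer_ge0 (Psi : Omega -> 'rV[R]_K -> R) :
  0 <= fine 'E_P[fun w => (\int[mu0]_(v in X) expR (- Psi w v))%R]%E.
Proof.
apply/fine_ge0/expectation_ge0 => w; apply: Rintegral_ge0 => u _.
exact: expR_ge0.
Qed.

Lemma measurable_enorm_vector_process J (f : 'I_J -> Omega -> 'rV[R]_K -> R)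
    (z : 'rV[R]_J) u :
  (forall j, measurable_fun setT (fun w => f j w u)) ->
  measurable_fun setT (fun w => enorm (z - vector_process f w u)).
Proof.
move=> mf; rewrite /enorm; apply: (measurableT_comp (f := @Num.sqrt R)).
  by apply: continuous_measurable_fun; exact: sqrt_continuous.
apply: measurable_sum => j; apply: measurable_funX.
under eq_fun do rewrite !mxE.
exact: measurable_funB.
Qed.

Lemma expectation_likelihood_le J (f : 'I_J -> Omega -> 'rV[R]_K -> R)
    (y z : 'rV[R]_J) (sigma2 : R) u : 0 < sigma2 ->
  (forall j, measurable_fun setT (fun w => f j w u)) ->
  (`|expR (- misfit y sigma2 z) -
     fine 'E_P[fun w => expR (- misfit y sigma2 (vector_process f w u))%R]|%:E <=
   (2 / Num.sqrt (2 * sigma2))%:E *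
   'E_P[fun w => enorm (z - vector_process f w u)%R])%E.
Proof.
move=> s0 mf.
have c0 : 0 < 2 / Num.sqrt (2 * sigma2).
  by rewrite divr_gt0// sqrtr_gt0 mulr_gt0.
have mexp : measurable_fun setT
    (fun w => expR (- misfit y sigma2 (vector_process f w u))).
  apply: measurableT_comp => //; apply: measurableT_comp => //.
  apply: measurable_funM => //; apply: measurable_funX.
  exact: measurable_enorm_vector_process.
apply: (le_trans (dist_expectation_le _ mexp _)).
  exists 1 => w; rewrite ger0_norm ?expR_ge0// -expR0 ler_expR oppr_le0.
  by rewrite divr_ge0 ?sqr_ge0// mulr_ge0// ltW.
rewrite unlock -ge0_integralZl_EFin ?(ltW c0)//; last 2 first.
- by move=> w _; rewrite lee_fin enorm_ge0.
- by apply/measurable_EFinP; exact: measurable_enorm_vector_process.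
apply: ge0_le_integral => //.
- by apply/measurable_EFinP/measurableT_comp => //; exact: measurable_funB.
- apply/measurable_funeM/measurable_EFinP.
  exact: measurable_enorm_vector_process.
- by move=> w _; rewrite -EFinM lee_fin; exact: expRN_misfit_lipschitz.
Qed.

End Posteriors.

(** * Hellinger error of the marginal approximations *)

Lemma cvgn_ubound (R : realType) (e : nat -> R) (l : R) :
  e n @[n --> \oo] --> l -> exists M, forall n, e n <= M.
Proof.
move=> el; have [|M [_ eM]] := @cvg_seq_bounded _ _ e; first by apply/cvg_ex; exists l.
exists (`|M| + 1) => n; rewrite (le_trans (ler_norm _))//; apply: eM => //.
by rewrite (le_lt_trans (ler_norm _))// ltrDl.
Qed.

Lemma supE_le (R : realType) (U : Type) (X : set U) (f : U -> R) (M : R) u :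
  (supE X f <= M%:E)%E -> X u -> f u <= M.
Proof.
by move=> fM Xu; rewrite -lee_fin (le_trans _ fM)//; apply: ereal_sup_ubound; exists u.
Qed.

Theorem theorem4p9 (R : realType) (K J : nat) (K_gt0 : (0 < K)%N) (J_gt0 : (0 < J)%N)
    (X : set 'rV[R]_K) (G : 'rV[R]_K -> 'rV[R]_J)
    (y : 'rV[R]_J) (sigma2 : R) (mu0 : probability (borel_rV R K) R)
    (d : measure_display) (Omega : measurableType d) (P : probability Omega R)
    (* prior processes *)
    (Phi0 : Omega -> 'rV[R]_K -> R) (G0 : 'I_J -> Omega -> 'rV[R]_K -> R)
    (* emulators, as functions of the set of design points *)
    (PhiE : {fset 'rV[R]_K} -> Omega -> 'rV[R]_K -> R)
    (GE : {fset 'rV[R]_K} -> 'I_J -> Omega -> 'rV[R]_K -> R)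
    (mPhi : {fset 'rV[R]_K} -> 'rV[R]_K -> R)
    (mG : {fset 'rV[R]_K} -> 'rV[R]_K -> 'rV[R]_J)
    (k : {fset 'rV[R]_K} -> 'rV[R]_K -> 'rV[R]_K -> R)
    (* the posterior and its marginal approximations *)
    (muy : probability (borel_rV R K) R)
    (muG muPhi : {fset 'rV[R]_K} -> probability (borel_rV R K) R)
    (CG : R) (epsG epsPhi epsk : nat -> R) :
  let Phi u := misfit y sigma2 (G u) in
  let GEv U := vector_process (GE U) in
  0 < sigma2 ->
  compact X ->
  measurable_fun (X : set (borel_rV R K)) (G : borel_rV R K -> borel_rV R J) ->
  mu0 X = 1%E ->
  density_wrt X mu0 muy (posterior_density X mu0 Phi) ->
  prior_processes P X Phi0 G0 ->
  epsG n @[n --> \oo] --> 0 ->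
  epsPhi n @[n --> \oo] --> 0 ->
  epsk n @[n --> \oo] --> 0 ->
  (supE X (fun u => enorm (G u)) <= CG%:E)%E ->
  exists C1 C2 : R,
  forall U : nat -> {fset 'rV[R]_K},
    (forall N, (0 < N)%N -> design X N (U N)) ->
    (forall N, (0 < N)%N ->
       predictive_processes P X (PhiE (U N)) (GE (U N))
         (mPhi (U N)) (mG (U N)) (k (U N))) ->
    (forall N, (0 < N)%N ->
       density_wrt X mu0 (muG (U N))
         (marginal_density X mu0 P
            (fun w u => misfit y sigma2 (GEv (U N) w u)))) ->
    (forall N, (0 < N)%N ->
       density_wrt X mu0 (muPhi (U N)) (marginal_density X mu0 P (PhiE (U N)))) ->
    (forall N, (0 < N)%N ->
       [/\ (supE X (fun u => enorm (G u - mG (U N) u)) <= (epsG N)%:E)%E,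
           (supE X (fun u => `|Phi u - mPhi (U N) u|%R) <= (epsPhi N)%:E)%E &
           (supE X (fun u => k (U N) u u) <= (epsk N)%:E)%E]) ->
    (forall N, (0 < N)%N ->
       increments_dominated P X (fun w u => PhiE (U N) w u - mPhi (U N) u) Phi0 /\
       (forall j, increments_dominated P X
          (fun w u => GE (U N) j w u - mG (U N) u 0 j) (G0 j))) ->
  forall delta : R, 0 < delta ->
  forall N, (0 < N)%N ->
    (hellinger X mu0 muy (muG (U N)) <=
       C1%:E * L2norm X mu0 (fun u =>
         'E_P[fun w => (enorm (G u - GEv (U N) w u) `^ (1 + delta))%R]
           `^ ((1 + delta)^-1)%R))%E /\
    (hellinger X mu0 muy (muPhi (U N)) <=
       C2%:E * L2norm X mu0 (fun u =>
         'E_P[fun w => (`|Phi u - PhiE (U N) w u| `^ (1 + delta))%R]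
           `^ ((1 + delta)^-1)%R))%E.
Proof.
move=> Phi GEv s0 cX _ X1 dmuy _ _ epsPhi0 epsk0 GCG.
have Phi_ge0 u : 0 <= Phi u.
  by rewrite /Phi /misfit divr_ge0 ?sqr_ge0// mulr_ge0// ltW.
(* The misfit is bounded on X, which bounds the unnormalised posterior density
   below by exp(-M). *)
pose M := (enorm y + CG) ^+ 2 / (2 * sigma2).
have PhiM u : X u -> Phi u <= M.
  move=> Xu; rewrite /Phi /misfit ler_wpM2r ?invr_ge0 ?mulr_ge0 ?(ltW s0)//.
  have GuC := supE_le GCG Xu.
  have C0 : 0 <= CG by exact: le_trans (enorm_ge0 _) GuC.
  rewrite lerXn2r// ?nnegrE ?addr_ge0 ?enorm_ge0//.
  by rewrite (le_trans (enormD_le _ _))// enormN lerD2l.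
have rM u : X u -> expR (- M) <= expR (- Phi u).
  by move=> Xu; rewrite ler_expR lerN2 PhiM.
have [E EPhi] := cvgn_ubound epsPhi0.
have [V Vk] := cvgn_ubound epsk0.
pose LG := 2 / Num.sqrt (2 * sigma2).
pose LPhi := 4 * Num.sqrt V * expR V + expR (E + V / 2) + 1.
exists (2 * LG / expR (- M)), (2 * LPhi / expR (- M)).
move=> U _ predU dmuG dmuPhi sup_eps _ delta delta0 N N0.
have [[gPhi _] gG _] := predU N N0.
have [_ supPhi supk] := sup_eps N N0.
have p1 : 1 < 1 + delta by rewrite ltrDl.
have Z0 : 0 <= (\int[mu0]_(v in X) expR (- Phi v))%R.
  by apply: Rintegral_ge0 => u _; exact: expR_ge0.
split.
- have LG0 : 0 < LG by rewrite divr_gt0// sqrtr_gt0 mulr_gt0.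
  apply: (hellinger_le cX X1 (expR_gt0 _) LG0 Z0 _ rM _ _ dmuy (dmuG N N0)).
  + exact: marginal_density_normalizer_ge0.
  + by move=> u _; apply/fine_ge0/expectation_ge0 => w; exact: expR_ge0.
  + move=> u Xu.
    have mGE j : measurable_fun setT (fun w => GE (U N) j w u).
      by have [] := gaussian_process_at (gG j).1 Xu.
    apply: (le_trans (expectation_likelihood_le P y (G u) s0 mGE)).
    apply: lee_wpmul2l; first by rewrite lee_fin ltW.
    apply: expectation_le_powR => //; first exact: measurable_enorm_vector_process.
    by move=> w; exact: enorm_ge0.
- have LPhi0 : 0 < LPhi.
    by rewrite ltr_wpDl// addr_ge0 ?expR_ge0// !mulr_ge0 ?sqrtr_ge0 ?expR_ge0.
  apply: (hellinger_le cX X1 (expR_gt0 _) LPhi0 Z0 _ rM _ _ dmuy (dmuPhi N N0)).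
  + exact: marginal_density_normalizer_ge0.
  + by move=> u _; apply/fine_ge0/expectation_ge0 => w; exact: expR_ge0.
  + move=> u Xu.
    have gu := gaussian_process_at gPhi Xu.
    have mu_ : measurable_fun setT (fun w => PhiE (U N) w u) by have [] := gu.
    apply: (le_trans (gaussian_rv_expRN_le (E := E) (V := V) gu (Phi_ge0 u) _ _)).
    * by rewrite (le_trans (ler_norm _))// (le_trans (supE_le supPhi Xu)).
    * by rewrite (le_trans (supE_le supk Xu)).
    apply: lee_wpmul2l; first by rewrite lee_fin ltW.
    rewrite (_ : (fun w => `|PhiE (U N) w u - Phi u|) =
                 fun w => `|Phi u - PhiE (U N) w u|); last first.
      by apply/funext => w; rewrite distrC.
    apply: expectation_le_powR => //.
    by apply: measurableT_comp => //; exact: measurable_funB.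
Qed.
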